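(* If $L$ is the double arrow space, then $L^n$ has the CSWP for every finite $n$.
   Context: All spaces are Hausdorff. The double arrow space is the set $I_{(0,1)}=\{(0,0),(1,0)\}\cup\big((0,1)\times\{0,1\}\big)$ (i.e. $[0,1]$ with every point other than $0,1$ split into two neighboring points), with the lexicographic order and the order topology. $L^n$ has the product topology. For compact $X$, $C(X)=C(X,\mathbb{C})$ is the algebra of continuous complex-valued functions on $X$ with the supremum norm. $X$ has the Complex Stone-Weierstrass Property (CSWP) iff every (complex) subalgebra $\mathcal{A}$ of $C(X)$ which separates points of $X$ and contains the constant functions is dense in $C(X)$. *)

(* Defs.v *)
From HB Require Import structures.
From mathcomp Require Import all_boot all_order all_algebra.
From mathcomp Require Import all_classical all_reals all_analysis.
From mathcomp Require Import complex.

Set Implicit Arguments.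
Unset Strict Implicit.
Unset Printing Implicit Defensive.

Import Order.TTheory GRing.Theory Num.Theory.
Import numFieldNormedType.Exports.

Local Open Scope classical_set_scope.
Local Open Scope ring_scope.
Local Open Scope complex_scope.

(* complex.v gives R[i] no topology; R[i]^o carries the one of the modulus. *)
HB.instance Definition _ (R : rcfType) := NormedModule.copy R[i] R[i]^o.

(* The level b : bool stands for the second coordinate, false for 0 and true
   for 1; bool carries the order false < true. *)
Definition double_arrow_pred (R : realType) : pred (R *l bool) :=
  fun p => [|| p == (0, false), p == (1, false) | 0 < p.1 < 1].

Record double_arrow_set (R : realType) : Type := DoubleArrowPoint {
  double_arrow_val : R *l bool;
  double_arrow_valP : double_arrow_pred double_arrow_val
}.

HB.instance Definition _ (R : realType) := [isSub for @double_arrow_val R].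
HB.instance Definition _ (R : realType) :=
  [Choice of double_arrow_set R by <:].

Fact double_arrow_display : Order.disp_t.
Proof. exact: Order.Disp tt tt. Qed.

HB.instance Definition _ (R : realType) :=
  [SubChoice_isSubOrder of double_arrow_set R by <: with double_arrow_display].

Definition double_arrow (R : realType) : topologicalType :=
  order_topology (double_arrow_set R).

Definition topological_power (X : topologicalType) (n : nat) : topologicalType :=
  prod_topology (fun _ : 'I_n => X).

Section CSWP.
Variables (R : realType) (X : topologicalType).
Implicit Types (f g : X -> R[i]) (A : set (X -> R[i])).

Definition CX : set (X -> R[i]) := [set f : X -> R[i] | continuous f].

(* The norm `|z| of R[i] takes its values in R[i] (with null imaginary part),
   hence the real part. *)
Definition supremum_norm f : \bar R :=
  ereal_sup (range (fun x => (complex.Re `|f x|)%:E)).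

Definition subalgebra_CX A : Prop :=
  [/\ A `<=` CX,
      A (cst 0),
      (forall f g, A f -> A g -> A (f \+ g)),
      (forall (c : R[i]) f, A f -> A (fun x => c * f x)) &
      (forall f g, A f -> A g -> A (f \* g))].

Definition contains_constants A : Prop := forall c : R[i], A (cst c).

Definition separates_points_of A : Prop :=
  forall x y : X, x <> y -> exists2 f, A f & f x <> f y.

Definition dense_in_CX A : Prop :=
  forall f, CX f -> forall e : R, 0 < e ->
    exists2 g, A g & (supremum_norm (f \- g)%R < e%:E)%E.

(* The property is only considered for compact Hausdorff spaces. *)
Definition CSWP : Prop :=
  [/\ compact [set: X], hausdorff_space X &
      forall A, subalgebra_CX A -> separates_points_of A ->
        contains_constants A -> dense_in_CX A].

End CSWP.
Arguments CSWP R X : clear implicits.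

(* Main.v *)
Require Import Defs.
From mathcomp Require Import all_boot all_order all_algebra.
From mathcomp Require Import all_classical all_reals all_analysis.
From mathcomp Require Import complex ring lra.

(* By induction on the number of coordinates that take more than one real value,
   the algebra A is shown to be dense on every closed subset. If f cannot be
   approximated within e on some closed set, let E be a minimal such set and F a
   minimal closed norming subset of E. It suffices to find a in A that is close to
   0 or 1 at each point of F, and to each of them at some point: being norming,
   F forces a ^ 2 - a to be small on E as well, so that E splits into two
   proper closed pieces on which f can be approximated, and a polynomial in a glues
   the two approximations.

   For a real s, A is dense on the slice of F where coordinate i equals s by the
   induction hypothesis, so some u in A is close to the indicator function of
   {x_i > s} (points over s being sent to either 0 or 1) near that slice. By Baire's
   theorem, on some open W meeting F these cuts have a common bound and a
   common domain of validity for a dense set of values s. Minimality of F yields g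
   in A with |g| <= 1 on F, |g| <= q < 1 outside W and |g| = 1 at some p in
   W. Products of cuts isolate a small box around p, with a bound independent
   of the box; multiplied by a large power of g / g p, which kills what happens
   outside W, and by some k in A which is 1 at p and vanishes on the finitely many
   other points that arbitrarily small boxes contain, they give a. *)

Set Implicit Arguments.
Unset Strict Implicit.
Unset Printing Implicit Defensive.

Import Order.TTheory GRing.Theory Num.Theory.
Import numFieldNormedType.Exports.

Local Open Scope classical_set_scope.
Local Open Scope ring_scope.

(** * Compact sets: chains, minimal closed subsets, a Baire category argument *)

Section CompactSets.
Variable X : topologicalType.
Implicit Types (E C O : set X) (G : set (set X)).

(** The traces on [E] of the members of [G] form a filter base because [G] is a chain. A cluster
    point in [E] lies in every member, since the members are closed. *)
Lemma compact_chain E G : compact E -> G !=set0 -> total_on G subset ->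
  (forall C, G C -> closed C /\ E `&` C !=set0) ->
  exists2 x, E x & forall C, G C -> C x.
Proof.
move=> cE [C0 GC0] totG hG.
pose F := filter_from G (fun C => E `&` C).
have FF : ProperFilter F.
  apply: filter_from_proper; last by move=> C /hG[].
  apply: filter_from_filter; first by exists C0.
  move=> C D GC GD; have [CD|DC] := totG _ _ GC GD.
    by exists C => // x [Ex Cx]; split; split => //; exact: CD.
  by exists D => // x [Ex Dx]; split; split => //; exact: DC.
have FE : F E by exists C0.
have [x [Ex clx]] := cE F FF FE; exists x => // C GC.
have [clC _] := hG _ GC; apply: clC => B xB.
have [|y [[_ Cy] By]] := clx (E `&` C) B _ xB; first by exists C.
by exists y.
Qed.

Lemma compact_increasing_cover E (O : nat -> set X) : compact E ->
  (forall m, open (O m)) -> (forall m k, (m <= k)%N -> O m `<=` O k) ->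
  (forall x, E x -> exists m, O m x) -> exists m, E `<=` O m.
Proof.
move=> cE oO incO covO; apply: contrapT => /forallNP nO.
have [||C [m _ <-]|x Ex hx] := @compact_chain E (range (fun m => ~` O m)) cE.
- by exists (~` O 0%N), 0%N.
- move=> _ _ [m _ <-] [k _ <-]; have [mk|km] := leqP m k.
    by right; apply: subsetC; exact: incO.
  by left; apply: subsetC; apply: incO; exact: ltnW.
- split; first exact: open_closedC.
  have /existsNP[x /not_implyP[Ex nOx]] := nO m.
  by exists x.
have [m Omx] := covO x Ex.
by apply: (hx (~` O m)) => //; exists m.
Qed.

(** Zorn's lemma is applied to the open sets that can be removed from [E] so that the rest still
    meets every [C i]. For each [i], [compact_chain] shows that the union of a chain of such sets
    can be removed too. The lemma serves twice: for a minimal set on which approximation fails, and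
    for a minimal norming set. *)
Lemma minimal_closed_set E (I : Type) (C : I -> set X) :
  compact E -> closed E -> (forall i, closed (C i)) ->
  (forall i, E `&` C i !=set0) ->
  exists F, [/\ F `<=` E, closed F, forall i, F `&` C i !=set0 &
    forall F', F' `<=` F -> closed F' -> (forall i, F' `&` C i !=set0) ->
    F `<=` F'].
Proof.
move=> cE clE clC EC.
pose P U := open U /\ forall i, (E `\` U) `&` C i !=set0.
have [G GP totG|U [[oU UC] maxU]] := @Zorn_bigcup X P.
  split; first by apply: bigcup_open => U /GP[].
  (* The empty chain is treated apart: its union is empty, and nothing is removed from [E]. *)
  move=> i; have [G0|/set0P[U0 GU0]] := eqVneq G set0.
    by rewrite G0 bigcup_set0 setD0.
  pose H := [set ~` U `&` C i | U in G].
  have [||D [U GU <-]|x Ex hx] := @compact_chain E H cE.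
  - by exists (~` U0 `&` C i), U0.
  - move=> _ _ [U GU <-] [V GV <-]; have [UV|VU] := totG _ _ GU GV.
      by right; apply: setSI; exact: subsetC.
    by left; apply: setSI; exact: subsetC.
  - have [oU /(_ i)[x [[Ex nUx] Cx]]] := GP _ GU.
    by split; [exact: closedI (open_closedC oU) (clC i)|exists x].
  have hxU U : G U -> (~` U `&` C i) x by move=> GU; apply: hx; exists U.
  exists x; split; last by have [] := hxU _ GU0.
  by split => // -[U /hxU[nUx _] /nUx].
exists (E `\` U); split => //.
  by rewrite setDE; apply: closedI => //; exact: open_closedC.
move=> F' F'E clF' F'C x [Ex nUx]; apply: contrapT => nF'x.
apply: (maxU (~` F')).
  rewrite properEneq; split.
    by apply/eqP => UF'; apply: nUx; rewrite UF'.
  by move=> y Uy F'y; have [] := F'E _ F'y.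
split; first exact: closed_openC.
move=> i; have [y [F'y Cy]] := F'C i; exists y; split => //.
by split=> [|/(_ F'y)]; first by have [] := F'E _ F'y.
Qed.

(** Baire's theorem on the compact space [E]: if no [T m] were dense in a nonempty relatively open
    part of [E], one could choose nested open sets meeting [E], the closure of each contained in its
    predecessor and avoiding the next [T m] on [E]. A common point of the closures in [E] would then
    lie in no [T m]. *)
Lemma compact_somewhere_dense E (T : nat -> set X) :
  hausdorff_space X -> compact [set: X] -> closed E -> E !=set0 ->
  (forall x, E x -> exists m, T m x) ->
  exists m W, [/\ open W, E `&` W !=set0 &
    forall O, open O -> E `&` W `&` O !=set0 -> E `&` W `&` O `&` T m !=set0].
Proof.
move=> hX cX clE E0 covT; apply: contrapT => nT.
have step m (W : set X) : open W -> E `&` W !=set0 ->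
    exists W', [/\ open W', E `&` W' !=set0, closure W' `<=` W &
      E `&` closure W' `&` T m = set0].
  move=> oW EW.
  have [U [oU [x [[Ex Wx] Ox]] nTO]] : exists O, [/\ open O,
      E `&` W `&` O !=set0 & E `&` W `&` O `&` T m = set0].
    apply: contrapT => nO; apply: nT; exists m, W; split=> // O oO EWO.
    apply: contrapT => /set0P/negP/negPn/eqP TU0.
    by apply: nO; exists O.
  have [V xV VWU] : filter_from (nbhs x) closure (W `&` U).
    apply: (@compact_regular X x setT hX cX filterT).
    by apply: open_nbhs_nbhs; split => //; exact: openI.
  exists (interior V); split.
  - exact: open_interior.
  - by exists x.
  - by move=> y /(closure_subset (@interior_subset _ _)) /VWU[].
  - rewrite -subset0 => y [[Ey cVy] Ty].
    have [Wy Oy] : (W `&` U) y.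
      by apply: VWU; apply: closure_subset cVy; exact: interior_subset.
    by rewrite -nTO.
pose S := {W : set X | open W /\ E `&` W !=set0}.
have S0 : open [set: X] /\ E `&` setT !=set0 by split; [exact: openT|rewrite setIT].
(* The stage number is carried along with the open set, so that the choice made at stage [m] is the
   one avoiding [T m]. *)
have next (mW : nat * S) : {mW' : nat * S | mW'.1 = mW.1.+1 /\
    closure (sval mW'.2) `<=` sval mW.2 /\
    E `&` closure (sval mW'.2) `&` T mW.1 = set0}.
  apply: cid; case: mW => m [W [oW EW]] /=.
  have [W' [oW' EW' cW' TW']] := step m W oW EW.
  by exists (m.+1, exist _ W' (conj oW' EW')).
pose s := fix s m := if m is k.+1 then sval (next (s k)) else (0%N, exist _ setT S0 : S).
pose W m := sval (s m).2.
have s1 m : (s m).1 = m.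
  elim: m => //= m IH; have [-> _] := svalP (next (s m)); by rewrite IH.
have sW m : closure (W m.+1) `<=` W m by have [_ [+ _]] := svalP (next (s m)).
have sT m : E `&` closure (W m.+1) `&` T m = set0.
  by have [_ [_ sTm]] := svalP (next (s m)); rewrite -[X in T X]s1.
have mW m k : (m <= k)%N -> W k `<=` W m.
  elim: k => [|k IH]; first by rewrite leqn0 => /eqP->.
  rewrite leq_eqVlt => /predU1P[->//|]; rewrite ltnS => /IH; apply: subset_trans.
  by apply: subset_trans (sW k); exact: subset_closure.
have [||C [m _ <-]|x Ex hx] :=
    @compact_chain E (range (fun m => closure (W m))) (subclosed_compact clE cX (@subsetT _ _)).
- by exists (closure (W 0%N)), 0%N.
- move=> _ _ [m _ <-] [k _ <-]; have [mk|km] := leqP m k.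
    by right; apply: closure_subset; exact: mW.
  by left; apply: closure_subset; apply: mW; exact: ltnW.
- split; first exact: closed_closure.
  have [_ [y [Ey Wy]]] := svalP (s m).2; exists y; split => //.
  exact: subset_closure.
have [m Tx] := covT x Ex.
have : (E `&` closure (W m.+1) `&` T m) x.
  by split => //; split => //; apply: hx; exists m.+1.
by rewrite sT.
Qed.

End CompactSets.

Local Open Scope complex_scope.

(** * The modulus with values in [R], and complex numbers close to 0 or 1 *)

Section Modulus.
Variable R : realType.
Implicit Types (z w : R[i]) (e : R).

Definition cmod z : R := complex.Re `|z|.

Lemma cmodE z : `|z| = (cmod z)%:C.
Proof. by rewrite /cmod normc_def. Qed.

Lemma cmod_ge0 z : 0 <= cmod z.
Proof. rewrite -lecR -cmodE; exact: normr_ge0. Qed.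

Lemma cmod_le0 z : (cmod z <= 0) = (z == 0).
Proof. rewrite -lecR -cmodE; exact: normr_le0. Qed.

Lemma cmod0 : cmod 0 = 0 :> R.
Proof. by rewrite /cmod normr0. Qed.

Lemma cmod1 : cmod 1 = 1 :> R.
Proof. by rewrite /cmod normr1. Qed.

Lemma cmodM z w : cmod (z * w) = cmod z * cmod w.
Proof. by apply: (@complexI R); rewrite rmorphM /= -!cmodE normrM. Qed.

Lemma cmodX z m : cmod (z ^+ m) = cmod z ^+ m.
Proof. by elim: m => [|m IH]; rewrite ?cmod1// !exprS cmodM IH. Qed.

Lemma cmodV z : cmod z^-1 = (cmod z)^-1.
Proof. by apply: (@complexI R); rewrite fmorphV /= -!cmodE normfV. Qed.

Lemma cmodN z : cmod (- z) = cmod z.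
Proof. by rewrite /cmod normrN. Qed.

Lemma cmodB z w : cmod (z - w) = cmod (w - z).
Proof. by rewrite -cmodN opprB. Qed.

Lemma ler_cmodD z w : cmod (z + w) <= cmod z + cmod w.
Proof. by rewrite -lecR rmorphD /= -!cmodE ler_normD. Qed.

Lemma ler_cmodDl z w : cmod z - cmod w <= cmod (z + w).
Proof.
by rewrite lerBlDr -[in X in X <= _](addrK w z) -[cmod w]cmodN ler_cmodD.
Qed.

Lemma cmod_bool (b : bool) : cmod b%:R = b%:R :> R.
Proof. by case: b; rewrite ?cmod1 ?cmod0. Qed.

Lemma continuous_cmod : continuous cmod.
Proof.
move=> z V /nbhs_ballP[e /= e0 eV].
have : nbhs z [set w | `|z - w| < e%:C] by exists e%:C => //=; rewrite ltcR.
apply: (@filterS _ (nbhs z)) => w /=; rewrite cmodE ltcR => zw; apply: eV.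
rewrite /ball /=; apply: le_lt_trans zw; rewrite ler_norml; apply/andP; split.
  by rewrite cmodB; have := ler_cmodDl w (- z); rewrite cmodN; lra.
by have := ler_cmodDl z (- w); rewrite cmodN.
Qed.

Definition approx_bool e (b : bool) z := cmod (z - b%:R) <= e.

Lemma approx_bool_le e e' (b : bool) z : e <= e' -> approx_bool e b z -> approx_bool e' b z.
Proof. by move=> ee' /le_trans; apply. Qed.

Lemma approx_bool_cmod e b z : approx_bool e b z -> cmod z <= 1 + e.
Proof.
rewrite /approx_bool => ez; have := ler_cmodD (z - b%:R) b%:R.
by rewrite subrK cmod_bool; case: b ez => /=; lra.
Qed.

Lemma approx_boolM e b b' z w : e <= 1 ->
  approx_bool e b z -> approx_bool e b' w -> approx_bool (3 * e) (b && b') (z * w).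
Proof.
move=> e1 ez ew; rewrite /approx_bool.
have -> : z * w - (b && b')%:R = (z - b%:R) * w + b%:R * (w - b'%:R).
  by case: b b' {ez ew} => -[] /=; ring.
apply: le_trans (ler_cmodD _ _) _; rewrite !cmodM cmod_bool.
have w2 := approx_bool_cmod ew.
have e0 : 0 <= e by exact: le_trans (cmod_ge0 _) ez.
have := ler_pM (cmod_ge0 _) (cmod_ge0 _) ez w2.
have : b%:R * cmod (w - b'%:R) <= e.
  by case: b {ez}; rewrite ?mul1r ?mul0r.
have : e * (1 + e) <= e * 2 by rewrite ler_wpM2l//; lra.
by lra.
Qed.

Lemma approx_boolC e b z : approx_bool e b z -> approx_bool e (~~ b) (1 - z).
Proof.
rewrite /approx_bool -cmodN; congr (cmod _ <= _).
by case: b => /=; ring.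
Qed.

(** One multiplication at most triples the error as long as it is at most 1, so the tolerance is
    divided by 3 for each factor. The resulting [d] depends on [m] and [e] only. *)
Lemma approx_bool_prod m e : 0 < e ->
  exists2 d, 0 < d <= e & forall (b : 'I_m -> bool) (z : 'I_m -> R[i]),
    (forall i, approx_bool d (b i) (z i)) ->
    approx_bool e [forall i, b i] (\prod_i z i).
Proof.
elim: m e => [|m IH] e e0.
  exists e; first by rewrite e0 lexx.
  move=> b z _; rewrite /approx_bool big_ord0.
  have -> : [forall i, b i] by apply/forallP => -[].
  by rewrite subrr cmod0 ltW.
pose e' := Num.min (e / 3) 1.
have e'0 : 0 < e' by rewrite lt_min ltr01 divr_gt0.
have e'e : e' <= e / 3 by rewrite ge_min lexx.
have e'1 : e' <= 1 by rewrite ge_min lexx orbT.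
have [d /andP[d0 de'] hd] := IH _ e'0.
exists d; first by rewrite d0/=; lra.
move=> b z bz; rewrite big_ord_recl.
have -> : [forall i, b i] = b ord0 && [forall i, b (lift ord0 i)].
  apply/forallP/andP => [h|[h0 /forallP h] i]; first by split=> //; apply/forallP.
  by case: (unliftP ord0 i) => [j|] ->.
apply: (@approx_bool_le (3 * e')); first by lra.
apply: approx_boolM => //; first exact: approx_bool_le (bz ord0).
exact: (hd (fun i => b (lift ord0 i)) (fun i => z (lift ord0 i))).
Qed.

(** The cubic that fixes 0 and 1 with zero derivative at both. It commutes with [z] going to
    [1 - z], which lets the case of 1 be reduced to that of 0. *)
Definition smoothstep z : R[i] := z ^+ 2 * (3 - 2 * z).

Lemma smoothstep_approx e b z : e <= 1 / 8 ->
  approx_bool e b z -> approx_bool (e / 2) b (smoothstep z).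
Proof.
move=> e8; wlog -> : b z / b = false.
  move=> H; case: b => [/approx_boolC|] ez; last exact: H.
  have {ez}/approx_boolC := H _ _ erefl ez; rewrite /approx_bool /=.
  by congr (cmod (_ - _) <= _); rewrite /smoothstep; ring.
rewrite /approx_bool !subr0 /smoothstep cmodM cmodX => ez.
have z0 := cmod_ge0 z.
have : cmod (3 - 2 * z) <= 3 + 2 * cmod z.
  have nat_cmod k : cmod k%:R = k%:R.
    by rewrite /cmod normr_nat -(rmorph_nat (real_complex R)).
  by apply: le_trans (ler_cmodD _ _) _; rewrite cmodN cmodM !nat_cmod.
have := sqr_ge0 (cmod z); nra.
Qed.

(** Each iteration of [smoothstep] halves the error, so one polynomial improves the precision near 0
    and near 1 at once. *)
Lemma amplify e : 0 < e -> exists Q : {poly R[i]}, forall b z,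
  approx_bool (1 / 8) b z -> approx_bool e b Q.[z].
Proof.
move=> e0; pose P m := exists Q : {poly R[i]}, forall b z,
  approx_bool (1 / 8) b z -> approx_bool ((1 / 8) / 2 ^+ m) b Q.[z].
have PP m : P m.
  elim: m => [|m [Q IH]].
    by exists 'X => b z; rewrite hornerX expr0 divr1.
  exists (Q ^+ 2 * (3%:P - 2%:P * Q)) => b z /IH /smoothstep_approx.
  rewrite !hornerE exprSr invfM mulrA; apply.
  by rewrite ler_pdivrMr ?exprn_gt0// ler_peMr// exprn_ege1// ler1n.
have [m me] : exists m : nat, 1 / 8 / 2 ^+ m < e.
  have /cvgrPdist_lt/(_ e e0)[m _ /(_ m (leqnn m))] :
      (fun m => geometric (1 / 8) (2^-1 : R) m) @ \oo --> 0.
    by apply: cvg_geometric; rewrite ger0_norm; lra.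
  rewrite /= sub0r normrN exprVn ger0_norm; first by exists m.
  by rewrite divr_ge0.
have [Q HQ] := PP m; exists Q => b z /HQ; apply: approx_bool_le.
exact: ltW.
Qed.

Lemma bounded_horner (Q : {poly R[i]}) (B : R) :
  exists C, forall z, cmod z <= B -> cmod Q.[z] <= C.
Proof.
elim/poly_ind: Q => [|Q c [C IH]].
  by exists 0 => z _; rewrite horner0 cmod0.
exists (C * B + cmod c) => z zB; rewrite !hornerE.
apply: le_trans (ler_cmodD _ _) _; rewrite lerD2r cmodM.
exact: ler_pM (cmod_ge0 _) (cmod_ge0 _) (IH _ zB) zB.
Qed.

End Modulus.

(** * Continuous real functions on compact sets *)

Section RealFunctionsOnCompacts.
Variables (R : realType) (X : topologicalType).
Implicit Types (E : set X) (phi : X -> R).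

Lemma compact_max E phi : compact E -> continuous phi -> E !=set0 ->
  exists2 c, E c & forall x, E x -> phi x <= phi c.
Proof.
move=> cE cphi E0; have [c] := compact_EVT_max E0 cE (continuous_subspaceT cphi).
rewrite inE => Ec hc; exists c => // x Ex; apply: hc; exact: mem_set.
Qed.

Lemma compact_bounded_above E phi : compact E -> continuous phi ->
  exists2 M, 0 <= M & forall x, E x -> phi x <= M.
Proof.
move=> cE cphi; have [->|/set0P E0] := eqVneq E set0; first by exists 0.
have [c Ec hc] := compact_max cE cphi E0; exists (Num.max 0 (phi c)).
  by rewrite le_max lexx.
by move=> x /hc; rewrite le_max orbC => ->.
Qed.

Lemma compact_lt_uniform E phi e : compact E -> continuous phi ->
  (forall x, E x -> phi x < e) -> exists2 e', e' < e & forall x, E x -> phi x <= e'.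
Proof.
move=> cE cphi he; have [->|/set0P E0] := eqVneq E set0.
  by exists (e - 1) => //; lra.
by have [c Ec hc] := compact_max cE cphi E0; exists (phi c) => //; exact: he.
Qed.

Lemma open_lt_fun phi e : continuous phi -> open [set x | phi x < e].
Proof. move=> cphi; exact: (open_comp (fun x _ => cphi x) (@open_lt R e)). Qed.

Lemma open_gt_fun phi e : continuous phi -> open [set x | e < phi x].
Proof. move=> cphi; exact: (open_comp (fun x _ => cphi x) (@open_gt R e)). Qed.

Lemma closed_le_fun phi e : continuous phi -> closed [set x | phi x <= e].
Proof.
move=> cphi; have -> : [set x | phi x <= e] = phi @^-1` [set y | y <= e] by [].
by apply: closed_comp => [x _|]; [exact: cphi|exact: closed_le].
Qed.

Lemma closed_ge_fun phi e : continuous phi -> closed [set x | e <= phi x].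
Proof.
move=> cphi; have -> : [set x | e <= phi x] = phi @^-1` [set y | e <= y] by [].
by apply: closed_comp => [x _|]; [exact: cphi|exact: closed_ge].
Qed.

Lemma continuous_cmod_comp (f : X -> R[i]) :
  continuous f -> continuous (fun x => cmod (f x)).
Proof. by move=> cf x; apply: continuous_comp; [exact: cf|exact: continuous_cmod]. Qed.

Lemma continuous_cmodB (f g : X -> R[i]) :
  continuous f -> continuous g -> continuous (fun x => cmod (f x - g x)).
Proof.
move=> cf cg; apply: continuous_cmod_comp => x.
exact: (@continuousB R[i] R[i] X f g x (cf x) (cg x)).
Qed.

End RealFunctionsOnCompacts.

(** * Gluing and norming sets in a subalgebra of functions *)

Section FunctionAlgebra.
Variables (R : realType) (X : topologicalType) (A : set (X -> R[i])).
Hypotheses (algA : subalgebra_CX A) (cstA : contains_constants A).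
Implicit Types (E : set X) (f g h a : X -> R[i]) (e : R).

Lemma subalg_continuous f : A f -> continuous f.
Proof. by case: algA => sub _ _ _ _ /sub. Qed.

Lemma subalgD f g : A f -> A g -> A (fun x => f x + g x).
Proof. by case: algA => _ _ + _ _; apply. Qed.

Lemma subalgM f g : A f -> A g -> A (fun x => f x * g x).
Proof. by case: algA => _ _ _ _; apply. Qed.

Lemma subalgZ c f : A f -> A (fun x => c * f x).
Proof. by case: algA => _ _ _ + _; apply. Qed.

Lemma subalgB f g : A f -> A g -> A (fun x => f x - g x).
Proof.
move=> Af Ag; have := subalgD Af (subalgZ (- 1) Ag).
by congr A; apply/funext => x; rewrite mulN1r.
Qed.

Lemma subalg_horner (Q : {poly R[i]}) f : A f -> A (fun x => Q.[f x]).
Proof.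
move=> Af; elim/poly_ind: Q => [|Q c IH].
  by have := cstA 0; congr A; apply/funext => x; rewrite horner0.
have := subalgD (subalgM IH Af) (cstA c).
by congr A; apply/funext => x; rewrite !hornerE.
Qed.

Lemma subalg_prod (I : Type) (s : seq I) (f : I -> X -> R[i]) :
  (forall i, A (f i)) -> A (fun x => \prod_(i <- s) f i x).
Proof.
move=> Af; elim: s => [|i s IH].
  by have := cstA 1; congr A; apply/funext => x; rewrite big_nil.
by have := subalgM (Af i) IH; congr A; apply/funext => x; rewrite big_cons.
Qed.

(** With [Q] from [amplify], the function [h0 + Q(a) * (h1 - h0)] is close to [h0] where [a] is near
    0 and to [h1] where [a] is near 1. By compactness the two strict bounds leave a margin below
    [e], which absorbs the error of [Q(a)]. *)
Lemma approx_bool_glue E f a e : compact E -> continuous f -> A a ->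
  (forall x, E x -> exists b, approx_bool (1 / 8) b (a x)) ->
  (forall b, exists2 h, A h & forall x, E x -> approx_bool (1 / 8) b (a x) ->
    cmod (f x - h x) < e) ->
  exists2 g, A g & forall x, E x -> cmod (f x - g x) < e.
Proof.
move=> cE cf Aa aE hb.
have cphi h : A h -> continuous (fun x => cmod (f x - h x)).
  by move=> /subalg_continuous; exact: continuous_cmodB.
have unif b : exists h e', [/\ A h, e' < e & forall x, E x ->
    approx_bool (1 / 8) b (a x) -> cmod (f x - h x) <= e'].
  have [h Ah hE] := hb b.
  have [|x [Ex ax]|e' e'e he'] := @compact_lt_uniform R X
      (E `&` [set x | cmod (a x - b%:R) <= 1 / 8]) _ e _ (cphi _ Ah).
  - apply: compact_closedI => //; apply: closed_le_fun.
    apply: continuous_cmodB; first exact: subalg_continuous.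
    exact: subalg_continuous (cstA _).
  - exact: hE.
  - by exists h, e'; split => // x Ex ax; exact: he'.
have [h0 [e0 [Ah0 e0e hE0]]] := unif false.
have [h1 [e1 [Ah1 e1e hE1]]] := unif true.
have [B B0 hB] := compact_bounded_above cE
  (continuous_cmodB (subalg_continuous Ah1) (subalg_continuous Ah0)).
pose e' := Num.max e0 e1.
have e'e : 0 < e - e' by rewrite subr_gt0 gt_max e0e e1e.
have [e0e' e1e'] : e0 <= e' /\ e1 <= e' by rewrite !le_max !lexx orbT; split.
(* The precision asked of [Q(a)]: multiplied by the bound [B] of [h1 - h0], it stays below the
   margin [e - e']. The added 1 keeps the denominator positive. *)
pose k := (e - e') / (B + 1).
have k0 : 0 < k by rewrite divr_gt0//; lra.
have kB : k * B < e - e'.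
  by rewrite -mulrA -[ltRHS]mulr1 ltr_pM2l// mulrC ltr_pdivrMr; lra.
have [Q hQ] := amplify k0.
exists (fun x => h0 x + Q.[a x] * (h1 x - h0 x)).
  by apply: subalgD => //; apply: subalgM; [exact: subalg_horner|exact: subalgB].
move=> x Ex; have [b ab] := aE x Ex; have Qx := hQ _ _ ab.
have small c : cmod c <= k -> cmod (c * (h1 x - h0 x)) < e - e'.
  move=> ck; apply: le_lt_trans kB; rewrite cmodM.
  by rewrite ler_pM ?cmod_ge0 ?hB.
case: b ab Qx => ab Qx.
  have -> : f x - (h0 x + Q.[a x] * (h1 x - h0 x)) =
    f x - h1 x - (Q.[a x] - 1) * (h1 x - h0 x) by ring.
  have := ler_cmodD (f x - h1 x) (- ((Q.[a x] - 1) * (h1 x - h0 x))).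
  by rewrite cmodN; have := small _ Qx; have := hE1 x Ex ab; lra.
have -> : f x - (h0 x + Q.[a x] * (h1 x - h0 x)) =
  f x - h0 x - (Q.[a x] - 0) * (h1 x - h0 x) by ring.
have := ler_cmodD (f x - h0 x) (- ((Q.[a x] - 0) * (h1 x - h0 x))).
by rewrite cmodN; have := small _ Qx; have := hE0 x Ex ab; lra.
Qed.

(* a ^ 2 - a is small on F, hence on E since F is norming. *)
Lemma approx_bool_norming E F h :
  (forall a x, A a -> E x -> exists2 y, F y & cmod (a x) <= cmod (a y)) ->
  A h -> (forall x, F x -> exists b, approx_bool (1 / 8) b (h x)) ->
  exists a, [/\ A a, forall x, E x -> exists b, approx_bool (1 / 8) b (a x) &
    forall b x, approx_bool (1 / 8) b (h x) -> approx_bool (1 / 8) b (a x)].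
Proof.
move=> normF Ah hF; have k0 : 0 < 1 / 128 :> R by lra.
have [Q hQ] := amplify k0; pose a x := Q.[h x].
have Aa : A a by exact: subalg_horner.
exists a; split => //; last first.
  by move=> b x /hQ; apply: approx_bool_le; lra.
move=> x Ex; have [|y Fy] := normF (fun x => a x * (a x - 1)) x _ Ex.
  by apply: subalgM => //; apply: subalgB => //; exact: cstA.
have [b /hQ aby] := hF y Fy.
(* This bound is the square of 1 / 8: at a point of [E] where [a] was farther than 1 / 8 from both 0
   and 1, the product would exceed it. The precision 1 / 128 on [F] suffices, as the other factor is
   below 2. *)
have small : cmod (a y * (a y - 1)) <= 1 / 64.
  have a0 := cmod_ge0 (a y); have a1 := cmod_ge0 (a y - 1).
  rewrite cmodM; case: b aby; rewrite /approx_bool ?subr0 => aby.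
    have := approx_bool_cmod aby; nra.
  have := ler_cmodD (a y) (- 1); rewrite cmodN cmod1; nra.
move=> /le_trans/(_ small); rewrite cmodM => ax.
have [ax0|ax0] := leP (cmod (a x)) (1 / 8); first by exists false; rewrite /approx_bool subr0.
exists true; rewrite /approx_bool leNgt; apply/negP => ax1; move: ax.
have := ltr_pM _ _ ax0 ax1; nra.
Qed.

End FunctionAlgebra.

Lemma ex_inv_succ_lt (R : realType) (e : R) : 0 < e ->
  exists m, forall j, (m <= j)%N -> j.+1%:R^-1 < e.
Proof. by move=> e0; have [m _ hm] := near_infty_natSinv_lt (PosNum e0); exists m. Qed.

Lemma ler_inv_succ (R : realType) m k : (m <= k)%N ->
  k.+1%:R^-1 <= m.+1%:R^-1 :> R.
Proof. by move=> mk; rewrite lef_pV2 ?posrE ?ltr0n// ler_nat. Qed.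

Lemma open_forall (X : topologicalType) (I : finType) (O : I -> set X) :
  (forall i, open (O i)) -> open [set x | forall i, O i x].
Proof.
move=> oO; rewrite openE => x Ox; apply: filter_forall => i.
by apply: open_nbhs_nbhs; split.
Qed.

Lemma cmod_prod_le (R : realType) m (c : R) (z : 'I_m -> R[i]) :
  (forall i, cmod (z i) <= c) -> cmod (\prod_i z i) <= c ^+ m.
Proof.
elim: m z => [|m IH] z zc; first by rewrite big_ord0 cmod1.
rewrite big_ord_recl cmodM exprS ler_pM ?cmod_ge0//.
by apply: IH => i; exact: zc.
Qed.

(** * Interpolation at finitely many points, and cuts along a real function *)

Section Cuts.
Variables (R : realType) (X : topologicalType) (A : set (X -> R[i])).
Hypotheses (algA : subalgebra_CX A) (cstA : contains_constants A).
Hypothesis sepA : separates_points_of A.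
Implicit Types (E W T : set X) (rho : X -> R) (u g k : X -> R[i]) (d M a : R).

Lemma interpolate E p : finite_set E -> ~ E p ->
  exists k, [/\ A k, k p = 1 & forall x, E x -> k x = 0].
Proof.
move=> /finite_seqP[s ->] /=; elim: s => [_|y s IH].
  by exists (fun=> 1); split => //; exact: cstA.
rewrite /= inE => /negP; rewrite negb_or => /andP[/eqP py /negP/IH[k [Ak kp ks]]].
have [g Ag gpy] := sepA py.
exists (fun x => k x * ((g p - g y)^-1 * (g x - g y))); split.
- apply: (subalgM algA) => //; apply: (subalgZ algA); apply: (subalgB algA) => //.
  exact: cstA.
- by rewrite kp mul1r mulVf// subr_eq0; exact/eqP.
- move=> x; rewrite /= inE => /predU1P[->|/ks->]; last by rewrite mul0r.
  by rewrite subrr !mulr0.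
Qed.

(* [c] is the supremum of the values of [rho] below [a]; the set of these values
   may have gaps, in which case the cut cannot be placed next to [a]. *)
Lemma one_sided_cut E W T rho d M a : continuous rho -> 0 <= d -> 1 <= M ->
  (forall O, open O -> E `&` W `&` O !=set0 -> E `&` W `&` O `&` T !=set0) ->
  (forall t, E t -> W t -> T t -> exists u, [/\ A u,
     forall x, E x -> cmod (u x) <= M & forall x, E x -> W x ->
     exists b : bool, [/\ approx_bool d b (u x),
       rho t < rho x -> b & rho x < rho t -> ~~ b]]) ->
  exists c, forall e, 0 < e -> exists u, [/\ A u,
     forall x, E x -> cmod (u x) <= M & forall x, E x -> W x ->
     exists b : bool, [/\ approx_bool d b (u x),
       a <= rho x -> b & rho x < a -> e < `|rho x - c| -> ~~ b]].
Proof.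
move=> crho d0 M1 denseT cutT.
pose S := [set rho x | x in E `&` W `&` [set x | rho x < a]].
(* If no value of [rho] on [E] and [W] is below [a], the constant 1 is a cut and the centre is
   arbitrary. *)
have [[_ [x0 [[Ex0 Wx0] x0a] _]]|S0] := pselect (S !=set0); last first.
  exists 0 => e _; exists (fun=> 1); split; first exact: cstA.
    by move=> x _; rewrite cmod1.
  move=> x Ex Wx; exists true; split => //; first by rewrite /approx_bool subrr cmod0.
  by move=> xa; exfalso; apply: S0; exists (rho x); exists x.
have supS : has_sup S.
  by split; [exists (rho x0), x0|exists a => _ [x [_ /ltW xa] <-]].
exists (sup S) => e e0.
have [_ [y [[Ey Wy] ya] <-] ey] := sup_adherent e0 supS.
(* Density gives [t] in [T] with [rho t] below [a] and above [sup S - e]. The cut at [rho t] is then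
   wrong only within [e] of the supremum. *)
have [||t [[[Et Wt] [ta et]] Tt]] :=
    denseT ([set x | rho x < a] `&` [set x | sup S - e < rho x]).
- by apply: openI; [exact: open_lt_fun|exact: open_gt_fun].
- by exists y.
have [u [Au uM uW]] := cutT t Et Wt Tt.
exists u; split => // x Ex Wx; have [b [ub tx xt]] := uW x Ex Wx.
exists b; split => //; first by move=> ax; apply: tx; exact: lt_le_trans ta ax.
move=> xa; have : rho x <= sup S.
  by apply: sup_upper_bound => //; exists x.
move=> xS; rewrite distrC ger0_norm ?subr_ge0// => ex; apply: xt.
by apply: le_lt_trans et; lra.
Qed.

(** A one-sided cut for [rho] is multiplied by one for [- rho], the latter made from the functions
    [1 - u], whence the bound [M + 1]. Neither the exceptional values [c] nor the bound depends on
    [e], which may thus be chosen after them. *)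
Lemma two_sided_cut E W T rho d M a : continuous rho -> 0 <= d <= 1 -> 1 <= M ->
  (forall O, open O -> E `&` W `&` O !=set0 -> E `&` W `&` O `&` T !=set0) ->
  (forall t, E t -> W t -> T t -> exists u, [/\ A u,
     forall x, E x -> cmod (u x) <= M & forall x, E x -> W x ->
     exists b : bool, [/\ approx_bool d b (u x),
       rho t < rho x -> b & rho x < rho t -> ~~ b]]) ->
  exists c : R * R, forall e, 0 < e -> exists u, [/\ A u,
     forall x, E x -> cmod (u x) <= M * (M + 1) & forall x, E x -> W x ->
     exists b : bool, [/\ approx_bool (3 * d) b (u x),
       rho x = a -> b & e < `|rho x - a| -> e < `|rho x - c.1| ->
         e < `|rho x - c.2| -> ~~ b]].
Proof.
move=> crho /andP[d0 d1] M1 denseT cutT.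
have [c1 hc1] := one_sided_cut a crho d0 M1 denseT cutT.
have crhoN : continuous (- rho) by move=> x; apply: continuousN; exact: crho.
have [||c2 hc2] := @one_sided_cut E W T (- rho) d (M + 1) (- a) crhoN d0 _ denseT.
- by lra.
- move=> t Et Wt Tt; have [u [Au uM uW]] := cutT t Et Wt Tt.
  exists (fun x => 1 - u x); split.
  + by apply: (subalgB algA) => //; exact: cstA.
  + move=> x /uM ux; apply: le_trans (ler_cmodD _ _) _.
    by rewrite cmodN cmod1; lra.
  + move=> x Ex Wx; have [b [ub tx xt]] := uW x Ex Wx.
    exists (~~ b); split; first exact: approx_boolC.
      by rewrite ltrN2.
    by rewrite ltrN2 negbK.
exists (c1, - c2) => e e0 /=.
have [u [Au uM uW]] := hc1 e e0; have [v [Av vM vW]] := hc2 e e0.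
exists (fun x => u x * v x); split; first exact: subalgM.
  by move=> x Ex; rewrite cmodM ler_pM ?cmod_ge0 ?uM ?vM.
move=> x Ex Wx; have [b [ub ax xa]] := uW x Ex Wx.
have [b' [vb' ax' xa']] := vW x Ex Wx.
exists (b && b'); split; first exact: approx_boolM.
  by move=> xa0; rewrite ax ?ax'// ?xa0// lerN2 xa0.
move=> ea e1 e2; have [xlt|xgt|xeq] := ltgtP (rho x) a.
- by rewrite (negbTE (xa xlt e1)).
- by rewrite (negbTE (xa' _ _)) ?andbF ?ltrN2// -opprD normrN -[c2]opprK.
- by move: ea; rewrite xeq subrr normr0 ltNge ltW.
Qed.

End Cuts.

(** * Density on closed sets, by induction on the non-constant coordinates *)

Section Coordinates.
Variables (R : realType) (X : topologicalType) (n : nat) (r : 'I_n -> X -> R).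
Hypotheses (compactX : compact [set: X]) (hausdorffX : hausdorff_space X).
Hypothesis continuous_r : forall i, continuous (r i).
Hypothesis finite_fibres : forall v : 'I_n -> R,
  finite_set [set x | forall i, r i x = v i].
Variable A : set (X -> R[i]).
Hypotheses (algA : subalgebra_CX A) (cstA : contains_constants A).
Hypothesis sepA : separates_points_of A.
Implicit Types (E W : set X) (f g h u : X -> R[i]).

(** The single number [m] controls both the bound of the cut and the width of the strip where it is
    valid. This makes the families indexed by [m] countable and increasing, as needed for the Baire
    argument. *)
Definition local_cut E i (s : R) (m : nat) (d : R) := exists u, [/\ A u,
  forall x, E x -> cmod (u x) <= m.+1%:R & forall x, E x ->
    `|r i x - s| < m.+1%:R^-1 -> exists b : bool, [/\ approx_bool d b (u x),
      s < r i x -> b & r i x < s -> ~~ b]].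

Lemma local_cut_le E i s m k d : (m <= k)%N ->
  local_cut E i s m d -> local_cut E i s k d.
Proof.
move=> mk [u [Au uM uE]]; exists u; split => // x Ex.
  by apply: le_trans (uM x Ex) _; rewrite ler_nat.
by move=> xs; apply: uE => //; exact: lt_le_trans xs (ler_inv_succ _ mk).
Qed.

(** An approximation of [f] on the slice over [s] persists near it: the open sets where it holds or
    where [r i] is farther than [1 / (m + 1)] from [s] increase with [m] and cover the compact
    [E]. *)
Lemma local_cut_slice E i s d f : closed E -> continuous f ->
  (forall x, exists b : bool, [/\ f x = b%:R,
     s < r i x -> b & r i x < s -> ~~ b]) ->
  (exists2 g, A g & forall x, E x -> r i x = s -> cmod (f x - g x) < d) ->
  exists m, local_cut E i s m d.
Proof.
move=> clE cf fb [g Ag gE].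
have cE : compact E by apply: (subclosed_compact clE compactX).
have cg := subalg_continuous algA Ag.
pose O m := [set x | cmod (g x - f x) < d] `|`
            [set x | m.+1%:R^-1 < `|r i x - s|].
have cr : continuous (fun x => `|r i x - s|).
  move=> x; apply: cvg_norm; apply: cvgB; [exact: continuous_r|exact: cvg_cst].
have [m||x Ex|m Em] := @compact_increasing_cover X E O cE.
- by apply: openU; [apply: open_lt_fun; exact: continuous_cmodB|exact: open_gt_fun].
- move=> m k mk x [Ox|Ox]; [by left|right].
  exact: le_lt_trans (ler_inv_succ _ mk) Ox.
- have [xs|xs] := eqVneq (r i x) s.
    by exists 0%N; left; rewrite /= cmodB; exact: gE.
  have [|m hm] := @ex_inv_succ_lt R `|r i x - s|; first by rewrite normr_gt0 subr_eq0.
  by exists m; right; exact: hm.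
have [B B0 gB] := compact_bounded_above cE (continuous_cmod_comp cg).
have [k kB] : exists k : nat, B <= k%:R.
  by exists (Num.truncn B).+1; apply: ltW; exact: truncnS_gt.
exists (maxn m k), g; split => // x Ex.
  apply: le_trans (gB x Ex) _; apply: le_trans kB _.
  by rewrite ler_nat (leq_trans (leq_maxr m k)).
move=> xs; have [b [fxb sx xs']] := fb x; exists b; split => //.
have [/ltW|/= mx] := Em x Ex; first by rewrite fxb.
have := lt_trans mx xs; rewrite ltNge ler_inv_succ//; exact: leq_maxl.
Qed.

(** The property characteristic of a Shilov boundary: every nonempty relatively open part of [E]
    contains the peak of some function of [A]. *)
Definition peaking E := forall W, open W -> E `&` W !=set0 ->
  exists g p, [/\ A g, E p /\ W p, cmod (g p) = 1,
    forall x, E x -> cmod (g x) <= 1 &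
    exists2 q : R, 0 <= q < 1 & forall x, E x -> ~ W x -> cmod (g x) <= q].

Lemma approx_indicator E : closed E -> peaking E ->
  (forall i x d, E x -> 0 < d -> exists m, local_cut E i (r i x) m d) ->
  (exists x y, [/\ E x, E y & x <> y]) ->
  exists h, [/\ A h, forall x, E x -> exists b, approx_bool (1 / 8) b (h x) &
    forall b, exists2 x, E x & approx_bool (1 / 8) b (h x)].
Proof.
move=> clE peakE cutE [x1 [x2 [Ex1 Ex2 x12]]].
have cE : compact E by apply: (subclosed_compact clE compactX).
have /(@approx_bool_prod R n)[d1 /andP[d10 d18] hd1] : 0 < 1 / 8 :> R by lra.
have half16 : 1 / 16 + 1 / 16 = 1 / 8 :> R by field.
have c16 : 1 / 16 <= 1 / 8 :> R by lra.
(* The factor 3 is the loss of precision in [two_sided_cut]. *)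
pose d := d1 / 3.
have d0 : 0 < d by rewrite /d; lra.
have d01 : 0 <= d <= 1 by rewrite /d; lra.
pose T m := [set x | forall i, local_cut E i (r i x) m d].
have covT x : E x -> exists m, T m x.
  move=> Ex; have /choice[m hm] i := cutE i x d Ex d0.
  exists (\max_i m i)%N => i; apply: local_cut_le (hm i).
  exact: leq_bigmax.
have [m [W0 [oW0 EW0 denseT0]]] : exists m W, [/\ open W, E `&` W !=set0 &
    forall O, open O -> E `&` W `&` O !=set0 -> E `&` W `&` O `&` T m !=set0].
  by apply: compact_somewhere_dense => //; exists x1.
have [|x0 [[[Ex0 W0x0] _] Tx0]] := denseT0 setT openT; first by rewrite setIT.
(* Coordinates of two points of [W] differ by less than [1 / (m + 1)], so a local cut at a point of
   [W] in [T m] is valid on all of [W]. *)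
pose W := W0 `&` [set x | forall i, `|r i x - r i x0| < m.+1%:R^-1 / 2].
have oW : open W.
  apply: openI => //; apply: (@open_forall _ _ (fun i => [set x | _ < _])) => i.
  apply: open_lt_fun => x; apply: cvg_norm; apply: cvgB; last exact: cvg_cst.
  exact: continuous_r.
have EW : E `&` W !=set0.
  by exists x0; split => //; split => // i; rewrite subrr normr0.
have denseT O : open O -> E `&` W `&` O !=set0 -> E `&` W `&` O `&` T m !=set0.
  move=> oO [x [[Ex [W0x Wx]] Ox]].
  have [||y [[[Ey W0y] [Wy Oy]] Ty]] := denseT0 (W `&` O); first exact: openI.
    by exists x.
  by exists y.
have cutW i t : E t -> W t -> T m t -> exists u, [/\ A u,
     forall x, E x -> cmod (u x) <= m.+1%:R & forall x, E x -> W x ->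
     exists b : bool, [/\ approx_bool d b (u x),
       r i t < r i x -> b & r i x < r i t -> ~~ b]].
  move=> Et [_ Wt] Tt; have [u [Au uM uE]] := Tt i.
  exists u; split => // x Ex [_ Wx]; apply: uE => //.
  apply: le_lt_trans (ler_distD (r i x0) _ _) _.
  by rewrite [m.+1%:R^-1]splitr ltrD// distrC.
have [g [p [Ag [Ep Wp] gp1 g1 [q /andP[q0 q1] gq]]]] := peakE W oW EW.
pose M : R := m.+1%:R.
have M1 : 1 <= M by rewrite ler1n.
have /choice[c hc] i := two_sided_cut algA cstA (r i p) (continuous_r (i := i))
  d01 M1 denseT (cutW i).
have [x3 Ex3 px3] : exists2 x, E x & x <> p.
  by have [x1p|] := pselect (x1 = p); [exists x2 => // x2p; apply: x12; rewrite x1p|exists x1].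
(* For each coordinate the cuts around [p] fail to exclude three values, however small [e] is. Only
   finitely many points have all coordinates among these, and [k] deals with them; it also vanishes
   at [x3], where the final function has to be near 0. *)
pose near3 x i := [\/ r i x = r i p, r i x = (c i).1 | r i x = (c i).2].
pose F := [set x | forall i, near3 x i].
have finF : finite_set F.
  pose v i (j : 'I_3) := nth 0 [:: r i p; (c i).1; (c i).2] j.
  apply: (@sub_finite_set _ _ (\bigcup_(phi in [set: {ffun 'I_n -> 'I_3}])
      [set x | forall i, r i x = v i (phi i)])); last first.
    by apply: bigcup_finite => // phi _; exact: finite_fibres.
  move=> x Fx; have /choice[phi hphi] i : exists j, r i x = v i j.
    by case: (Fx i) => ->; [exists 0|exists 1|exists (inord 2)]; rewrite /v ?inordK.
  by exists [ffun i => phi i] => //= i; rewrite ffunE.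
have [k [Ak kp kF]] : exists k, [/\ A k, k p = 1 &
    forall x, ((F `|` [set x3]) `\ p) x -> k x = 0].
  apply: (interpolate algA cstA sepA) => [|[_ /(_ erefl)//]].
  by apply: finite_setD; rewrite finite_setU; split.
have ck := continuous_cmod_comp (subalg_continuous algA Ak).
have [K K0 kK] := compact_bounded_above cE ck.
pose kap := 1 / (16 * (K + 1)).
have kap0 : 0 < kap by rewrite /kap divr_gt0//; nra.
have kapK : kap * K <= 1 / 16.
  by rewrite /kap mulrAC ler_pdivrMr; nra.
have kap8 : kap <= 1 / 8.
  by rewrite /kap ler_pdivrMr; nra.
have [Q hQ] := amplify kap0.
pose B := (M * (M + 1)) ^+ n.
have B0 : 0 <= B by rewrite exprn_ge0//; nra.
have [C hC] := bounded_horner Q B.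
have C0 : 0 <= C by apply: le_trans (hC 0 _); rewrite ?cmod_ge0 ?cmod0.
(* [C] bounds the polynomial in the product of cuts for every box width, so [N] can be fixed before
   the width [e], which will depend on [N] through [G]. *)
have [N hN] : exists N, C * (K * q ^+ N) <= 1 / 8.
  have /cvgrPdist_le/(_ (1 / 8))[//|N _ /(_ N (leqnn N))] :
      geometric (C * K) q @ \oo --> 0 by apply: cvg_geometric; rewrite ger0_norm.
  rewrite /= sub0r normrN -mulrA => CKq; exists N.
  exact: le_trans (ler_norm _) CKq.
pose G x := k x * ((g p)^-1 * g x) ^+ N.
have AG : A G.
  apply: (subalgM algA) => //.
  have := subalg_horner algA cstA 'X^N (subalgZ algA (g p)^-1 Ag).
  by congr A; apply/funext => x; rewrite hornerXn.
have GE x : cmod (G x) = cmod (k x) * cmod (g x) ^+ N.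
  by rewrite cmodM cmodX cmodM cmodV gp1 invr1 mul1r.
have GK x : E x -> cmod (G x) <= K.
  move=> Ex; rewrite GE -[K]mulr1 ler_pM ?cmod_ge0 ?kK ?exprn_ge0 ?cmod_ge0//.
  by rewrite exprn_ile1 ?cmod_ge0 ?g1.
have gp0 : g p != 0 by rewrite -cmod_le0 gp1 ler10.
have Gp : G p = 1 by rewrite /G kp mulVf// expr1n mul1r.
have GF x : E x -> F x -> G x = 0 \/ G x = 1.
  move=> Ex Fx; have [->|/eqP xp] := eqVneq x p; first by right.
  by left; rewrite /G kF ?mul0r//; split=> //; left.
pose V := [set x | cmod (G x - 0) < 1 / 16] `|` [set x | cmod (G x - 1) < 1 / 16].
have cG := subalg_continuous algA AG.
have oV : open V.
  have cV b : continuous (fun x => cmod (G x - b)).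
    exact: continuous_cmodB cG (subalg_continuous algA (cstA b)).
  by apply: openU; apply: open_lt_fun; exact: cV.
pose far (e : R) x i := [/\ e < `|r i x - r i p|, e < `|r i x - (c i).1| &
  e < `|r i x - (c i).2|].
(* On [F] the function [G] is 0 or 1, and off [F] some coordinate avoids its three values.
   Compactness turns this into one width [e]: where [G] is not near 0 or 1, some cut of width [e] is
   near 0. *)
have [e e0 he] : exists2 e : R, 0 < e & forall x, E x -> V x \/ exists i, far e x i.
  pose O j := V `|` \bigcup_i [set x | far j.+1%:R^-1 x i].
  have [j|j l jl x [Vx|[i _ [xp x1' x2']]]|x Ex|j Ej] := @compact_increasing_cover X E O cE.
  - apply: openU => //; apply: bigcup_open => i _.
    have cr y : continuous (fun x => `|r i x - y|).
      by move=> x; apply: cvg_norm; apply: cvgB; [exact: continuous_r|exact: cvg_cst].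
    have -> : [set x | far j.+1%:R^-1 x i] = [set x | j.+1%:R^-1 < `|r i x - r i p|] `&`
        ([set x | j.+1%:R^-1 < `|r i x - (c i).1|] `&`
         [set x | j.+1%:R^-1 < `|r i x - (c i).2|]).
      by apply/seteqP; split=> x [? ]; [split|case; split].
    by apply: openI; [|apply: openI]; exact: open_gt_fun.
  - by left.
  - by right; exists i => //; split; apply: le_lt_trans (ler_inv_succ _ jl) _.
  - have [Fx|/existsNP[i nxi]] := pselect (F x).
      exists 0%N; left; case: (GF x Ex Fx) => Gx; [left|right];
        by rewrite /= Gx subrr cmod0 divr_gt0.
    have dist_gt0 y : r i x <> y -> 0 < `|r i x - y|.
      by move=> /eqP xy; rewrite normr_gt0 subr_eq0.
    have [np n1 n2] : [/\ r i x <> r i p, r i x <> (c i).1 & r i x <> (c i).2].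
      by split=> xy; apply: nxi; [exact: Or31|exact: Or32|exact: Or33].
    have [|j hj] := @ex_inv_succ_lt R (Num.min `|r i x - r i p|
        (Num.min `|r i x - (c i).1| `|r i x - (c i).2|)).
      by rewrite !lt_min !dist_gt0.
    exists j; right; exists i => //; have := hj j (leqnn j).
    by rewrite !lt_min => /andP[? /andP[]].
  - by exists j.+1%:R^-1; [rewrite invr_gt0 ltr0n|move=> x /Ej[|[i _]]; [left|right; exists i]].
have /choice[z hz] i := hc i e e0.
have Az i : A (z i) by have [] := hz i.
pose w x := Q.[\prod_i z i x].
have Aw : A w by apply: (subalg_horner algA cstA); exact: (subalg_prod algA cstA).
have wW x : E x -> W x -> exists b : 'I_n -> bool, [/\
    approx_bool kap [forall i, b i] (w x), x = p -> [forall i, b i] &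
    (exists i, far e x i) -> ~~ [forall i, b i]].
  move=> Ex Wx.
  have /choice[b hb] i : exists b : bool, [/\ approx_bool d1 b (z i x),
       r i x = r i p -> b & far e x i -> ~~ b].
    have [_ _ /(_ x Ex Wx)[b [zb xp xf]]] := hz i; exists b; split => //.
      by apply: approx_bool_le zb; rewrite mulrC mulfVK.
    by case; exact: xf.
  exists b; split.
  - by apply: hQ; apply: hd1 => i; have [] := hb i.
  - by move=> xp; apply/forallP => i; have [_ + _] := hb i; apply; rewrite xp.
  - by move=> [i xf]; apply/forallPn; exists i; have [_ _] := hb i; apply.
have wC x : E x -> cmod (w x) <= C.
  move=> Ex; apply: hC; apply: cmod_prod_le => i.
  by have [_ + _] := hz i; apply.
exists (fun x => w x * G x); split; first exact: subalgM.
- move=> x Ex; have wG : cmod (w x * G x) = cmod (w x) * cmod (G x) by exact: cmodM.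
  have [Wx|nWx] := pselect (W x); last first.
    exists false; rewrite /approx_bool subr0 wG; apply: le_trans hN.
    rewrite ler_pM ?cmod_ge0 ?wC// GE ler_pM ?cmod_ge0 ?exprn_ge0 ?cmod_ge0 ?kK//.
    by rewrite lerXn2r ?nnegrE ?cmod_ge0// gq.
  have [b [wb _ xf]] := wW x Ex Wx.
  have small s : cmod s <= kap -> cmod (s * G x) <= 1 / 16.
    by move=> sk; apply: le_trans kapK; rewrite cmodM ler_pM ?cmod_ge0 ?GK.
  move: wb xf; case: [forall i, b i] => wb xf; last first.
    exists false; rewrite /approx_bool subr0; have := small (w x).
    move: wb; rewrite /approx_bool subr0 => wb /(_ wb) /le_trans; exact.
  have [|/xf//] := he x Ex; have := small _ wb.
  have near b' : cmod (G x - b') < 1 / 16 ->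
      cmod ((w x - 1) * G x) <= 1 / 16 -> cmod (w x * G x - b') <= 1 / 8.
    have -> : w x * G x - b' = (w x - 1) * G x + (G x - b') by ring.
    move=> Gx wG1; apply: le_trans (ler_cmodD _ _) _.
    by rewrite -half16; exact: lerD wG1 (ltW Gx).
  by move=> sG [Gx|Gx]; [exists false|exists true]; exact: near.
- case; last first.
    exists x3 => //; rewrite /G kF ?mul0r ?mulr0 /approx_bool ?subrr ?cmod0//.
    by split => //; right.
  exists p => //; rewrite Gp mulr1; have [b [wb bp _]] := wW p Ep Wp.
  by apply: approx_bool_le kap8 _; rewrite -(bp erefl).
Qed.

(** Peaking comes from minimality: if [W] meets [F], then [F] without [W] is not norming, so some
    [a] in [A] has a value on [E] larger in modulus than all its values there. Dividing [a] by its
    value at a point of [F] of maximal modulus gives the peak function. *)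
Lemma minimal_norming_set E : closed E -> exists F, [/\ F `<=` E, closed F,
  peaking F &
  forall a x, A a -> E x -> exists2 y, F y & cmod (a x) <= cmod (a y)].
Proof.
move=> clE; have cE : compact E by apply: (subclosed_compact clE compactX).
(* Indexed by pairs of a function and a point of [E], the sets [C] are all met by a subset of [E]
   exactly when it is norming. *)
pose I := {ax : (X -> R[i]) * X | A ax.1 /\ E ax.2}.
pose C (ax : I) := [set y | cmod ((sval ax).1 (sval ax).2) <= cmod ((sval ax).1 y)].
have cA a : A a -> continuous (fun x => cmod (a x)).
  by move=> /(subalg_continuous algA); exact: continuous_cmod_comp.
have [|[[a x] [/= Aa Ex]]|F [FE clF FC minF]] := @minimal_closed_set X E I C cE clE.
- by move=> [[a x] [/= Aa Ex]]; apply: closed_ge_fun; exact: cA.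
- by exists x; split => //; rewrite /C /=.
have normF a x : A a -> E x -> exists2 y, F y & cmod (a x) <= cmod (a y).
  move=> Aa Ex; have [y [Fy ay]] := FC (exist _ (a, x) (conj Aa Ex)).
  by exists y.
exists F; split => // W oW [y [Fy Wy]].
(* If [W] contains [F], there is nothing to make small and the constant 1 peaks. *)
have [FW0|/set0P[z [Fz nWz]]] := eqVneq (F `\` W) set0.
  exists (cst 1), y; split=> //; first exact: cmod1.
    by move=> x _; rewrite cmod1.
  exists 0; first by rewrite lexx ltr01.
  by move=> x Fx nWx; have : (F `\` W) x by []; rewrite FW0.
have clFW : closed (F `\` W) by rewrite setDE; apply: closedI => //; exact: open_closedC.
have : ~ forall i, (F `\` W) `&` C i !=set0.
  by move=> /(minF _ (@subDsetl _ _ _) clFW)/(_ y Fy)[].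
move=> /existsNP[[[a x0] [/= Aa Ex0]]] /= Ca.
have ax0 x : F x -> ~ W x -> cmod (a x) < cmod (a x0).
  move=> Fx nWx; rewrite ltNge; apply/negP => ax; apply: Ca.
  by exists x.
have [y1 Fy1 ay1] := normF a x0 Aa Ex0.
have cF : compact F by apply: (subclosed_compact clF compactX).
have [|p Fp pmax] := compact_max cF (cA a Aa); first by exists y.
have ap0 : 0 < cmod (a p).
  apply: lt_le_trans (pmax _ Fy1); apply: lt_le_trans ay1.
  exact: le_lt_trans (cmod_ge0 (a z)) (ax0 z Fz nWz).
have Ag : A (fun x => (a p)^-1 * a x) by exact: subalgZ.
exists (fun x => (a p)^-1 * a x), p; split=> //.
- split => //; apply: contrapT => /(ax0 p Fp); apply/negP; rewrite -leNgt.
  exact: le_trans ay1 (pmax _ Fy1).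
- by rewrite cmodM cmodV mulVf// gt_eqF.
- by move=> x /pmax; rewrite cmodM cmodV ler_pdivrMl// mulr1.
have [|x [Fx nWx]|q q1 hq] := @compact_lt_uniform R X (F `\` W) _ 1 _ (cA _ Ag).
- exact: subclosed_compact clFW compactX _.
- rewrite cmodM cmodV ltr_pdivrMl// mulr1; apply: lt_le_trans (pmax _ Fy1).
  exact: lt_le_trans (ax0 x Fx nWx) ay1.
exists (Num.max 0 q); first by rewrite le_max lexx gt_max ltr01.
by move=> x Fx nWx; rewrite le_max hq ?orbT.
Qed.

Hypothesis cut_r : forall i s, exists2 f : X -> R[i], continuous f &
  forall x, exists b : bool, [/\ f x = b%:R, s < r i x -> b & r i x < s -> ~~ b].

Definition nonconstant_coords E : {set 'I_n} :=
  [set i | `[< exists x y, [/\ E x, E y & r i x <> r i y] >]].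

Lemma nonconstant_coordsP E i :
  reflect (exists x y, [/\ E x, E y & r i x <> r i y]) (i \in nonconstant_coords E).
Proof. by rewrite inE; exact: asboolP. Qed.

Lemma subalg_dense_on E f e : closed E -> continuous f -> 0 < e ->
  exists2 g, A g & forall x, E x -> cmod (f x - g x) < e.
Proof.
have [m] := ubnP #|nonconstant_coords E|.
elim: m E f e => // m IH E f e; rewrite ltnS => dimE clE cf e0.
apply: contrapT => nE.
have cE : compact E by apply: (subclosed_compact clE compactX).
(* A closed set meets every [C a] exactly when no function of [A] approximates [f] within [e] on
   it. *)
pose C (a : {a | A a}) := [set x | e <= cmod (f x - sval a x)].
have [[a Aa]|[a Aa]|E1 [E1E clE1 E1C minE1]] := @minimal_closed_set X E _ C cE clE.
- apply: closed_ge_fun.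
  exact: (continuous_cmodB cf (subalg_continuous algA Aa)).
- apply: contrapT => nEC; apply: nE; exists a => // x Ex; rewrite ltNge.
  by apply/negP => ex; apply: nEC; exists x.
have [E2 [E21 clE2 peakE2 normE2]] := minimal_norming_set clE1.
have [x0 [E1x0 _]] := E1C (exist _ _ (cstA 0)).
have [p E2p _] := normE2 _ x0 (cstA 0) E1x0.
(* If [E2] were the single point [p], then [a - a p] would vanish on [E2], hence on [E1] by norming.
   As [A] separates points, [E1] would be [p] alone, where the constant [f p] approximates [f]. *)
have two : exists x y, [/\ E2 x, E2 y & x <> y].
  apply: contrapT => n2.
  have E2sub x : E2 x -> x = p.
    by move=> E2x; apply: contrapT => xp; apply: n2; exists x, p.
  have E1sub x : E1 x -> x = p.
    move=> E1x; apply: contrapT => /sepA[a Aa]; apply.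
    have [|y /E2sub->] := normE2 (fun x => a x - a p) x _ E1x.
      by apply: (subalgB algA) => //; exact: cstA.
    by rewrite subrr cmod0 cmod_le0 subr_eq0 => /eqP.
  have [x [/E1sub->]] := E1C (exist _ _ (cstA (f p))).
  by rewrite /C /= subrr cmod0 leNgt e0.
have cutE2 i x d : E2 x -> 0 < d -> exists m, local_cut E2 i (r i x) m d.
  (* A coordinate constant on [E2] has no point strictly on either side, and the constant 1 is a
     cut. *)
  move=> E2x d0; have [iE2|niE2] := boolP (i \in nonconstant_coords E2); last first.
    exists 0%N, (cst 1); split; first exact: cstA.
      by move=> y _; rewrite cmod1.
    move=> y E2y _; exists true; split => //.
      by rewrite /approx_bool subrr cmod0 ltW.
    move=> yx; exfalso; move/nonconstant_coordsP: niE2; apply.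
    by exists x, y; split => // xy; move: yx; rewrite xy ltxx.
  have [fc cfc hfc] := cut_r i (r i x).
  apply: (local_cut_slice clE2 cfc hfc).
  (* Coordinate [i] varies on [E] but is constant on the slice [S], so the induction hypothesis
     applies to [S]. *)
  pose S := E2 `&` [set y | r i y = r i x].
  have clS : closed S.
    apply: closedI => //.
    have -> : [set y | r i y = r i x] =
        [set y | r i y <= r i x] `&` [set y | r i x <= r i y].
      apply/seteqP; split => y /=; first by move=> ->; rewrite lexx.
      by move=> [yx xy]; apply/eqP; rewrite eq_le yx xy.
    by apply: closedI; [exact: closed_le_fun|exact: closed_ge_fun].
  have [|g Ag gS] := IH S fc d _ clS cfc d0; last by exists g => // y E2y yx; exact: gS.
  apply: leq_trans dimE; apply: proper_card; apply/properP; split.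
    apply/fintype.subsetP => j /nonconstant_coordsP[y [z [[E2y _] [E2z _] yz]]].
    by apply/nonconstant_coordsP; exists y, z; split=> //; apply: E1E; exact: E21.
  exists i.
    move: iE2 => /nonconstant_coordsP[y [z [E2y E2z yz]]].
    by apply/nonconstant_coordsP; exists y, z; split=> //; apply: E1E; exact: E21.
  by apply/nonconstant_coordsP => -[y [z [[_ yx] [_ zx]]]]; rewrite yx zx.
have [h [Ah hE2 hb]] := approx_indicator clE2 peakE2 cutE2 two.
have [a [Aa aE1 ha]] := approx_bool_norming algA cstA normE2 Ah hE2.
have cE1 : compact E1 by apply: (subclosed_compact clE1 compactX).
have [b|g Ag gE1] := @approx_bool_glue _ _ _ algA cstA E1 f a e cE1 cf Aa aE1; last first.
  by have [x [E1x]] := E1C (exist _ g Ag); rewrite /C /= leNgt gE1.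
pose Y := E1 `&` [set x | cmod (a x - b%:R) <= 1 / 8].
have clY : closed Y.
  apply: closedI => //; apply: closed_le_fun.
  exact: (continuous_cmodB (subalg_continuous algA Aa)
    (subalg_continuous algA (cstA _))).
(* [Y] misses a point of [E2] at which [a] is near the other truth value, so by minimality of [E1]
   it cannot meet every [C i]. *)
have : ~ forall i, Y `&` C i !=set0.
  move=> /(minE1 Y (@subIsetl _ _ _) clY) E1Y.
  have [x E2x /ha ax] := hb (~~ b).
  have [_ /= ax'] := E1Y x (E21 x E2x).
  have : approx_bool (1 / 8) true (a x) /\ approx_bool (1 / 8) false (a x).
    by case: b ax ax' {Y clY E1Y}.
  rewrite /approx_bool subr0 cmodB => -[a1 a0].
  by have := ler_cmodD (1 - a x) (a x); rewrite subrK cmod1; lra.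
move=> /existsNP[[g Ag] Cg]; exists g => // x E1x ax; rewrite ltNge.
by apply/negP => fx; apply: Cg; exists x.
Qed.

End Coordinates.

Theorem CSWP_of_coordinates (R : realType) (X : topologicalType) (n : nat)
    (r : 'I_n -> X -> R) :
  compact [set: X] -> hausdorff_space X -> (forall i, continuous (r i)) ->
  (forall v : 'I_n -> R, finite_set [set x | forall i, r i x = v i]) ->
  (forall i s, exists2 f : X -> R[i], continuous f &
    forall x, exists b : bool,
      [/\ f x = b%:R, s < r i x -> b & r i x < s -> ~~ b]) ->
  CSWP R X.
Proof.
move=> cX hX cr finr cutr; split => // A algA sepA cstA f cf e e0.
(* Strict pointwise bounds only give a large inequality for the supremum; halving [e] restores
   strictness. *)
have e20 : 0 < e / 2 by rewrite divr_gt0.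
have [g Ag fg] := subalg_dense_on cX hX cr finr algA cstA sepA cutr
  (@closedT X) cf e20.
exists g => //; apply: (@le_lt_trans _ _ (e / 2)%:E); last first.
  by rewrite lte_fin; lra.
apply: ge_ereal_sup => _ [x _ <-]; rewrite lee_fin; apply: ltW; exact: fg.
Qed.

(** * The double arrow space: projection to the real line, clopen cuts, compactness *)

Section DoubleArrow.
Variable R : realType.
Local Notation L := (order_topology (double_arrow_set R)).
Implicit Types (x y p : L) (s a : R).

Definition arrow_fst (x : L) : R := (double_arrow_val x).1.

Definition arrow_snd (x : L) : bool := (double_arrow_val x).2.

Lemma double_arrow_lt x y :
  (x < y)%O = (arrow_fst x < arrow_fst y) || (arrow_fst x == arrow_fst y) && (~~ arrow_snd x && arrow_snd y).
Proof.
have -> : (x < y)%O = ((x : double_arrow_set R) < y)%O by [].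
rewrite ltEsub Order.ProdLexiOrder.ltEprodlexi /arrow_fst /arrow_snd /=.
by have [] := ltgtP (double_arrow_val x).1 (double_arrow_val y).1 => //= _;
  case: (double_arrow_val x).2 (double_arrow_val y).2 => -[].
Qed.

Lemma arrow_fst_itv x : 0 <= arrow_fst x <= 1.
Proof.
case: x => -[x b]; rewrite /arrow_fst /= => /or3P[/eqP[-> _]|/eqP[-> _]|/= /andP[x0 x1]].
- by rewrite lexx ler01.
- by rewrite lexx ler01.
- by rewrite !ltW.
Qed.

Lemma arrow_snd_itv x : arrow_snd x -> 0 < arrow_fst x < 1.
Proof.
by case: x => -[x b]; rewrite /arrow_fst /arrow_snd /=;
  case/or3P => [/eqP[_ ->]|/eqP[_ ->]|].
Qed.

Lemma arrow_fst_snd_inj x y : arrow_fst x = arrow_fst y -> arrow_snd x = arrow_snd y -> x = y.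
Proof.
rewrite /arrow_fst /arrow_snd => c l; apply: val_inj; rewrite /=.
by rewrite [LHS]surjective_pairing [RHS]surjective_pairing c l.
Qed.

Lemma double_arrow_point s b : 0 < s < 1 ->
  exists p : L, arrow_fst p = s /\ arrow_snd p = b.
Proof.
move=> s01; have sP : double_arrow_pred ((s, b) : R *l bool).
  by rewrite /double_arrow_pred s01 !orbT.
by exists (DoubleArrowPoint sP).
Qed.

Lemma open_arrow_fst_gt a : open [set x : L | a < arrow_fst x].
Proof.
have [a0|a0] := ltP a 0.
  have -> : [set x : L | a < arrow_fst x] = setT; last exact: openT.
  by apply/seteqP; split=> // x _ /=; have /andP[+ _] := arrow_fst_itv x; exact: lt_le_trans.
have [a1|a1] := leP 1 a.
  have -> : [set x : L | a < arrow_fst x] = set0; last exact: open0.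
  rewrite -subset0 => x /=; have /andP[_ x1] := arrow_fst_itv x.
  by rewrite ltNge (le_trans x1).
(* The set is the open ray above the largest point over [a]: the upper one if [a] is positive, the
   only one if [a] is 0. *)
have [p [pa pl]] : exists p : L, arrow_fst p = a /\ (arrow_snd p = false -> a = 0).
  move: a0; rewrite le_eqVlt => /predU1P[<-|a0]; last first.
    have [|p [pa pt]] := @double_arrow_point a true; first by rewrite a0.
    by exists p; rewrite pt.
  have P0 : double_arrow_pred ((0, false) : R *l bool) by rewrite /double_arrow_pred eqxx.
  by exists (DoubleArrowPoint P0).
have -> : [set x : L | a < arrow_fst x] = [set` `]p, +oo[%O]; last exact: (@rray_open _ L p).
apply/seteqP; split => x /=; rewrite in_itv /= andbT double_arrow_lt pa.
  by move=> ->.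
move=> /orP[//|/andP[/eqP ax /andP[/negbTE/pl a00 /arrow_snd_itv]]].
by rewrite -ax a00 ltxx.
Qed.

Lemma open_arrow_fst_lt a : open [set x : L | arrow_fst x < a].
Proof.
have [a0|a0] := leP a 0.
  have -> : [set x : L | arrow_fst x < a] = set0; last exact: open0.
  rewrite -subset0 => x /=; have /andP[x0 _] := arrow_fst_itv x.
  by rewrite ltNge (le_trans a0).
have [a1|a1] := ltP 1 a.
  have -> : [set x : L | arrow_fst x < a] = setT; last exact: openT.
  by apply/seteqP; split=> // x _ /=; have /andP[_] := arrow_fst_itv x; move=> /le_lt_trans; apply.
have [p [pa pl]] : exists p : L, arrow_fst p = a /\ arrow_snd p = false.
  move: a1; rewrite le_eqVlt => /predU1P[->|a1]; last first.
    by have [|p [pa pf]] := @double_arrow_point a false; [rewrite a0|exists p].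
  have P1 : double_arrow_pred ((1, false) : R *l bool).
    by rewrite /double_arrow_pred eqxx orbT.
  by exists (DoubleArrowPoint P1).
have -> : [set x : L | arrow_fst x < a] = [set` `]-oo, p[%O]; last exact: (@lray_open _ L p).
apply/seteqP; split => x /=; rewrite in_itv /= double_arrow_lt pa pl !andbF ?orbF //.
Qed.

Lemma continuous_arrow_fst : continuous arrow_fst.
Proof.
move=> x V /nbhs_ballP[e /= e0 eV].
apply: (@filterS _ (nbhs x) _ ([set y : L | arrow_fst x - e < arrow_fst y] `&`
    [set y : L | arrow_fst y < arrow_fst x + e])).
  move=> y [/= ey ye]; apply: eV; rewrite /ball /= ltr_distlC.
  by rewrite ey ye.
apply: open_nbhs_nbhs; split.
  by apply: openI; [exact: open_arrow_fst_gt|exact: open_arrow_fst_lt].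
by split => /=; lra.
Qed.

(** The two points over [s] are neighbours in the order, so the open ray above the lower one and the
    open ray below the upper one are complementary. *)
Lemma clopen_cut s : 0 < s < 1 -> exists U : set L, [/\ open U, open (~` U),
  forall x, s < arrow_fst x -> U x & forall x, arrow_fst x < s -> ~ U x].
Proof.
move=> s01; have [p [ps pl]] := double_arrow_point true s01.
have [p' [ps' pl']] := double_arrow_point false s01.
have Upp' : ~` [set` `]-oo, p[%O] = [set` `]p', +oo[%O] :> set L.
  apply/seteqP; split=> x /=; rewrite !in_itv /= andbT !double_arrow_lt ps pl ps' pl' /=;
    by rewrite andbT; have [] := ltgtP (arrow_fst x) s => //= _; case: (arrow_snd x).
exists [set` `]p', +oo[%O]; split.
- exact: (@rray_open _ L p').
- rewrite -Upp' setCK; exact: (@lray_open _ L p).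
- by move=> x sx; rewrite /= in_itv /= andbT double_arrow_lt ps' sx.
- by move=> x xs; rewrite /= in_itv /= andbT double_arrow_lt ps' pl' ltNge (ltW xs) gt_eqF.
Qed.

(** Neighbourhoods of [p] contain intervals around it. On each side, either the filter already stays
    on the right side of [p], or every point beyond [p] differs from it in the first coordinate, and
    then convergence of first coordinates suffices. *)
Lemma cvg_double_arrow (F : set_system L) (FF : ProperFilter F) p :
  arrow_fst @ F --> arrow_fst p ->
  (F [set y : L | (p <= y)%O] \/
    forall l, (l < p)%O -> arrow_fst l < arrow_fst p) ->
  (F [set y : L | (y <= p)%O] \/
    forall u, (p < u)%O -> arrow_fst p < arrow_fst u) ->
  F --> (p : L).
Proof.
move=> Fp hl hu.
have lF (l : L) : (l < p)%O -> F [set y : L | (l < y)%O].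
  move=> lp; case: hl => [pF|/(_ l lp) lp'].
    by apply: filterS pF => y /= py; exact: lt_le_trans lp py.
  have Fl : F [set y : L | arrow_fst l < arrow_fst y] := Fp _ (lt_nbhsr lp').
  by apply: filterS Fl => y /= ly; rewrite double_arrow_lt ly.
have uF (u : L) : (p < u)%O -> F [set y : L | (y < u)%O].
  move=> pu; case: hu => [pF|/(_ u pu) pu'].
    by apply: filterS pF => y /= yp; exact: le_lt_trans yp pu.
  have Fu : F [set y : L | arrow_fst y < arrow_fst u] := Fp _ (lt_nbhsl pu').
  by apply: filterS Fu => y /= yu; rewrite double_arrow_lt yu.
move=> V; rewrite (@itv_nbhsE _ L) => -[[l u] [+ +]] luV.
case: l u luV => [[]l|[]] [[]u|[]] luV //= _; rewrite in_itv /= ?andbT => lpu.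
- have /andP[/lF lF' /uF uF'] := lpu.
  apply: filterS (filterI lF' uF') => y [ly yu]; apply: luV.
  by rewrite /= in_itv /= ly.
- apply: filterS (lF _ lpu) => y ly; apply: luV; by rewrite /= in_itv /= ly.
- apply: filterS (uF _ lpu) => y ly; apply: luV; by rewrite /= in_itv /=.
- by apply: filterS filterT => y _; apply: luV; rewrite /= in_itv.
Qed.

(** The first coordinates of an ultrafilter converge to some [s] in the unit interval, and the
    ultrafilter decides between the points over [s]. *)
Lemma compact_double_arrow : compact [set: L].
Proof.
rewrite compact_ultra => F FU _.
have FF : ProperFilter F by exact: ultra_proper.
have F01 : (arrow_fst @ F) `[0, 1]%classic.
  apply: (@filterS _ F _ setT); last exact: filterT.
  by move=> x _; rewrite /= in_itv /=; exact: arrow_fst_itv.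
have [s [s01 cls]] := @segment_compact R 0 1 (arrow_fst @ F) _ F01.
have Fs : arrow_fst @ F --> s.
  move=> V sV; have [//|FnV] := in_ultra_setVsetC (arrow_fst @^-1` V) FU.
  by have [z [nVz Vz]] := cls (~` V) V FnV sV.
have lower l p : arrow_fst p = s -> arrow_snd p = false -> (l < p)%O -> arrow_fst l < arrow_fst p.
  by move=> _ pl; rewrite double_arrow_lt pl !andbF orbF.
have upper u p : arrow_fst p = s -> arrow_snd p = true -> (p < u)%O -> arrow_fst p < arrow_fst u.
  by move=> _ pl; rewrite double_arrow_lt pl !andbF orbF.
have [s_in|s_out] := boolP (0 < s < 1); last first.
  have [p [ps pl]] : exists p : L, arrow_fst p = s /\ arrow_snd p = false.
    have sP : double_arrow_pred ((s, false) : R *l bool).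
      have /andP[s0 s1] : 0 <= s <= 1 by move: s01; rewrite /= in_itv.
      rewrite /double_arrow_pred; have [->|sn0] := eqVneq s 0; first by rewrite eqxx.
      have [->|sn1] := eqVneq s 1; first by rewrite eqxx orbT.
      by move: s_out; rewrite !lt_neqAle s0 s1 eq_sym sn0 sn1.
    by exists (DoubleArrowPoint sP).
  exists p; split => //; apply: cvg_double_arrow; rewrite ?ps//; right.
    by move=> l; rewrite -ps; exact: lower.
  move=> u; rewrite double_arrow_lt ps => /orP[//|/andP[/eqP su /andP[_ /arrow_snd_itv]]].
  by rewrite -su (negbTE s_out).
have [p [ps pl]] := double_arrow_point true s_in.
have [p' [ps' pl']] := double_arrow_point false s_in.
(* The complement of the points at or above the upper point [p] consists of those at or below the
   lower point [p']; the limit is [p] or [p'] accordingly. *)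
have [Fp|Fp] := in_ultra_setVsetC [set y : L | (p <= y)%O] FU.
  exists p; split => //; apply: cvg_double_arrow; rewrite ?ps//; first by left.
  by right=> u; rewrite -ps; exact: upper.
exists p'; split => //; apply: cvg_double_arrow; rewrite ?ps'//.
  by right=> l; rewrite -ps'; exact: lower.
left; apply: filterS Fp => y /= /negP; rewrite -ltNge leNgt !double_arrow_lt ps pl ps' pl' /=.
by rewrite andbT; have [] := ltgtP (arrow_fst y) s => //= _; case: (arrow_snd y).
Qed.

End DoubleArrow.

(** * Finite powers of the double arrow space *)

Lemma continuous_indicator (R : realType) (X : topologicalType) (U : set X) :
  open U -> open (~` U) -> continuous (fun x => (`[< U x >])%:R : R[i]).
Proof.
move=> oU oCU x V /nbhs_singleton Vx.
have xU : nbhs x [set y | `[< U y >] = `[< U x >]].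
  have [Ux|nUx] := pselect (U x).
    have : nbhs x U by apply: open_nbhs_nbhs.
    by apply: filterS => y Uy; rewrite /= !asboolT.
  have : nbhs x (~` U) by apply: open_nbhs_nbhs.
  by apply: filterS => y nUy; rewrite /= !asboolF.
by apply: filterS xU => y /= ->.
Qed.

Theorem theorem1p6 (R : realType) (n : nat) :
  CSWP R (topological_power (double_arrow R) n).
Proof.
pose T := fun _ : 'I_n => double_arrow R.
pose r i (x : topological_power (double_arrow R) n) : R := arrow_fst (proj i x).
apply: (@CSWP_of_coordinates R _ n r).
- have := @tychonoff 'I_n T (fun=> setT) (fun=> @compact_double_arrow R).
  by congr compact; apply/seteqP; split.
- by apply: (@hausdorff_product 'I_n T) => i; exact: order_hausdorff.
- move=> i x; exact: (@continuous_comp (topological_power (double_arrow R) n)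
    (double_arrow R) R (proj i) (@arrow_fst R) x (@proj_continuous 'I_n T i x)
    (@continuous_arrow_fst R _)).
(* A point over [v] is determined by its levels, one Boolean for each coordinate, so the fibre is
   finite. *)
- move=> v; pose D := [set w : {ffun 'I_n -> R * bool} | forall i, (w i).1 = v i].
  have finD : finite_set D.
    apply: (@sub_finite_set _ _
      [set [ffun i => (v i, b i)] | b in [set: {ffun 'I_n -> bool}]]).
      move=> w Dw; exists [ffun i => (w i).2] => //.
      by apply/ffunP => i; rewrite !ffunE -Dw -surjective_pairing.
    by apply: finite_image; exact: finite_finset.
  have fD : finite_set ((fun x : topological_power (double_arrow R) n =>
      [ffun i => (arrow_fst (proj i x), arrow_snd (proj i x))]) @^-1` D).
    apply: finite_preimage => //.
    move=> x y _ _ /ffunP xy; apply: functional_extensionality_dep => i.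
    by have := xy i; rewrite !ffunE => -[]; exact: arrow_fst_snd_inj.
  by apply: sub_finite_set fD => x xv i; rewrite ffunE; exact: xv.
(* Outside the open unit interval a constant is a cut: no coordinate is below [s] if [s] is at most
   0, and none is above [s] if [s] is at least 1. *)
- move=> i s; have [s01|s01] := boolP (0 < s < 1).
    have [U [oU oCU sU Us]] := clopen_cut s01.
    exists (fun x => (`[< U (proj i x) >])%:R).
      apply: (@continuous_indicator R (topological_power (double_arrow R) n)
        (@proj 'I_n T i @^-1` U)).
        by apply: open_comp => // x _; exact: proj_continuous.
      have -> : ~` (@proj 'I_n T i @^-1` U) = @proj 'I_n T i @^-1` (~` U) by [].
      by apply: open_comp => // x _; exact: proj_continuous.
    move=> x; exists `[< U (proj i x) >]; split=> // h; apply/asboolP; first exact: sU.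
    exact: Us.
  have [s0|s0] := leP s 0.
    exists (fun=> 1); first exact: cst_continuous.
    move=> x; exists true; split=> // xs; have /andP[] := arrow_fst_itv (proj i x).
    by rewrite leNgt (lt_le_trans xs s0).
  exists (fun=> 0); first exact: cst_continuous.
  move=> x; exists false; split=> // sx; have /andP[_] := arrow_fst_itv (proj i x).
  by move: s01; rewrite s0 /= -leNgt => /le_lt_trans/(_ sx); rewrite leNgt => ->.
Qed.
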